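(* Let $G=(V,E)$ be a finite simple graph. Then $$\mathcal{E}(G)\;\le\; 2e_{11}+\sum_{v\in V'}\sqrt{3\,l(v)+d(v)}.$$
   Context: Graphs are finite, simple and undirected. The energy of a graph $G$ on $n$ vertices is $\mathcal{E}(G)=\sum_{i=1}^n|\lambda_i|$, where $\lambda_1,\dots,\lambda_n$ are the eigenvalues (with multiplicity) of its adjacency matrix. $d(v)$ denotes the degree of a vertex $v$. A leaf is a vertex of degree $1$. $l(v)$ is the number of neighbors of $v$ that are leaves. $V'=\{v\in V: d(v)\ge 2\}$ is the set of inner vertices. $e_{11}$ is the number of edges of $G$ both of whose endpoints are leaves. *)

(* Defs.v *)
From HB Require Import structures.
From mathcomp Require Import all_boot all_order all_algebra.

Set Implicit Arguments.
Unset Strict Implicit.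
Unset Printing Implicit Defensive.

Import Order.TTheory GRing.Theory Num.Theory.

Local Open Scope ring_scope.

Section Eigenvalues.
Variables (C : numClosedFieldType) (n : nat).
Implicit Type A : 'M[C]_n.

Definition eigenvalues A : seq C := sval (closed_field_poly_normal (char_poly A)).

(* The characteristic polynomial is monic, so [eigenvalues A] lists its roots,
   each repeated according to its algebraic multiplicity. *)
Lemma char_poly_eigenvalues A :
  char_poly A = \prod_(z <- eigenvalues A) ('X - z%:P).
Proof.
rewrite /eigenvalues; case: closed_field_poly_normal => s /= {1}->.
by rewrite (monicP (char_poly_monic A)) scale1r.
Qed.

Lemma size_eigenvalues A : size (eigenvalues A) = n.
Proof.
by apply: succn_inj; rewrite -(size_char_poly A) char_poly_eigenvalues
  size_prod_XsubC.
Qed.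

End Eigenvalues.

(* A simple graph on [V] is a symmetric and irreflexive relation [e : rel V]. *)
Section Graph.
Variables (V : finType) (e : rel V).

Definition adjacency (C : numClosedFieldType) : 'M[C]_#|V| :=
  \matrix_(i, j) (e (enum_val i) (enum_val j))%:R.

(* The eigenvalues of an adjacency matrix are real; they are taken in a closed
   field [C] (e.g. [algC]) because characteristic polynomials split there. *)
Definition energy (C : numClosedFieldType) : C :=
  \sum_(z <- eigenvalues (adjacency C)) `|z|.

Definition neighbors (v : V) : {set V} := [set w | e v w].

Definition degree (v : V) : nat := #|neighbors v|.

Definition leaves : {set V} := [set v | degree v == 1%N].

Definition leaf_degree (v : V) : nat := #|neighbors v :&: leaves|.

Definition inner : {set V} := [set v | (2 <= degree v)%N].

Definition edges : {set {set V}} :=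
  [set [set p.1; p.2] | p : V * V & e p.1 p.2].

Definition leaf_edges : {set {set V}} := [set a in edges | a \subset leaves].

End Graph.

(* Main.v *)
(* By the spectral theorem the energy is [\tr (A *m S)], where [S] is a
   Hermitian unitary matrix (the sign of [A]), hence at most the sum of
   [`|S u v|] over the ordered pairs of adjacent vertices. Charge every edge
   between a leaf and an inner vertex to its inner end: an inner vertex [v] then
   carries [\sum_u c u * `|S v u|], with [c u = 2] on the leaf neighbours and
   [c u = 1] on the other ones. As the rows of [S] are unit vectors,
   Cauchy-Schwarz bounds this by the square root of
   4 l(v) + (d(v) - l(v)) = 3 l(v) + d(v). The pairs of adjacent leaves
   contribute at most 1 each, that is 2 per edge. *)
Require Import Defs.
From HB Require Import structures.
From mathcomp Require Import all_boot all_order all_algebra.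

Set Implicit Arguments.
Unset Strict Implicit.
Unset Printing Implicit Defensive.

Import Order.TTheory GRing.Theory Num.Theory.

Local Open Scope ring_scope.

Lemma char_poly_conjugate (R : comUnitRingType) n (P A : 'M[R]_n) :
  P \in unitmx -> char_poly (invmx P *m A *m P) = char_poly A.
Proof.
move=> uP; pose Q m p := @map_mx _ _ (@polyC R) m p.
have conj_mx : char_poly_mx (invmx P *m A *m P) =
    Q _ _ (invmx P) *m char_poly_mx A *m Q _ _ P.
  rewrite /char_poly_mx mulmxBr mulmxBl -!map_mxM; congr (_ - _).
  rewrite -mulmxA mul_scalar_mx -scalemxAr -map_mxM mulVmx //.
  by rewrite map_mx1 scalemx1.
rewrite /char_poly conj_mx !det_mulmx mulrAC -det_mulmx.
by rewrite -map_mxM mulVmx // map_mx1 det1 mul1r.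
Qed.

Section HermitianMatrices.
Variables (C : numClosedFieldType) (n : nat).
Implicit Type A : 'M[C]_n.
Local Open Scope sesquilinear_scope.

(** The spectral theorem makes [A] similar to [diag_mx (spectral_diag A)], and a factorization into
    monic linear polynomials is unique. *)
Lemma perm_eigenvalues_spectral_diag A : A \is normalmx ->
  perm_eq (eigenvalues A) [seq spectral_diag A 0 i | i : 'I_n].
Proof.
move=> /orthomx_spectralP A_eq; apply: prod_XsubC_eq.
rewrite -char_poly_eigenvalues [in LHS]A_eq.
rewrite char_poly_conjugate ?spectral_unit // char_poly_trig;
  last exact: diag_mx_is_trig.
rewrite big_image /=; apply: eq_bigr => i _.
by rewrite mxE eqxx.
Qed.

Lemma sum_norm_eigenvalues_hermitian A : A \is hermsymmx ->
  exists S : 'M[C]_n, [/\ S^t* = S, S *m S = 1%:M &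
    \sum_(z <- eigenvalues A) `|z| = \tr (A *m S)].
Proof.
move=> hA; have nA := hermitian_normalmx hA.
have /orthomx_spectralP A_eq := nA.
have /mxOverP realA := hermitian_spectral_diag_real hA.
set P := spectralmx A in A_eq; set d := spectral_diag A in A_eq realA.
have uP : P \in unitmx by exact: spectral_unit.
have PV : invmx P = P^t* by rewrite invmx_unitary ?spectral_unitarymx.
(* A zero eigenvalue gets sign 1 rather than 0, so that [S] squares to the identity even when [A] is
   singular. *)
pose s : 'rV[C]_n := \row_i (if 0 <= d 0 i then 1 else -1).
exists (invmx P *m diag_mx s *m P); split.
- rewrite PV !trmx_mul !map_mxM trmxCK mulmxA tr_diag_mx map_diag_mx.
  congr (_ *m diag_mx _ *m _); apply/rowP => i; rewrite !mxE.
  by case: ifP => _; rewrite ?rmorphN rmorph1.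
- rewrite !mulmxA mulmxK // -(mulmxA (invmx P)) mulmx_diag.
  rewrite (_ : \row__ _ = const_mx 1) ?diag_const_mx ?mulmx1 ?mulVmx //.
  apply/rowP => i; rewrite !mxE.
  by case: ifP => _; rewrite ?mulrNN mulr1.
- rewrite (perm_big _ (perm_eigenvalues_spectral_diag nA)) /= big_image /=.
  rewrite [in RHS]A_eq !mulmxA mulmxK // -(mulmxA (invmx P)) mulmx_diag.
  rewrite mxtrace_mulC mulmxA mulmxV // mul1mx mxtrace_diag.
  apply: eq_bigr => i _; rewrite !mxE -/d; have := realA 0 i.
  rewrite realE; case: ifP => [d_ge0 _|_ /= d_le0].
    by rewrite mulr1 ger0_norm.
  by rewrite mulrN1 ler0_norm.
Qed.

End HermitianMatrices.

(** Cauchy-Schwarz against a unit vector: with [x] the inner product, the residual of [c] after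
    projection on [a] has squared norm [K - x ^+ 2]. *)
Lemma sum_le_sqrtC (C : numClosedFieldType) (I : finType) (c a : I -> C) :
  (forall i, 0 <= c i) -> (forall i, 0 <= a i) -> \sum_i a i ^+ 2 = 1 ->
  \sum_i c i * a i <= sqrtC (\sum_i c i ^+ 2).
Proof.
move=> c_ge0 a_ge0 a1; set x := \sum_i c i * a i; set K := \sum_i _.
have x_ge0 : 0 <= x by apply: sumr_ge0 => i _; rewrite mulr_ge0.
have K_ge0 : 0 <= K by apply: sumr_ge0 => i _; rewrite exprn_ge0.
rewrite -(sqrCK x_ge0) ler_sqrtC ?nnegrE ?exprn_ge0 // -subr_ge0.
have -> : K - x ^+ 2 = \sum_i (c i - x * a i) ^+ 2.
  transitivity (\sum_i (c i ^+ 2 - (x * (c i * a i)) *+ 2 + x ^+ 2 * a i ^+ 2)).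
    rewrite big_split sumrB sumrMnl /= -!mulr_sumr a1 mulr1 -/x -/K.
    by rewrite -expr2 mulr2n opprD addrA addrNK.
  by apply: eq_bigr => i _; rewrite sqrrB mulrCA exprMn.
apply: sumr_ge0 => i _; rewrite -realEsqr.
by rewrite rpredB ?rpredM ?ger0_real.
Qed.

Section Graph.
Variables (V : finType) (e : rel V).
Hypotheses (e_sym : symmetric e) (e_irr : irreflexive e).

(** A vertex with a neighbour has positive degree, so degree below 2 means degree 1. *)
Lemma mem_leaves_adjacent u v : e u v -> (v \in leaves e) = (v \notin inner e).
Proof.
move=> euv; rewrite !inE -leqNgt.
have : (0 < degree e v)%N by apply/card_gt0P; exists u; rewrite inE e_sym.
by case: degree => [|[|]].
Qed.

(** The fibre of [f] over an edge [[set x; y]] contains at most the two orderings [(x, y)] and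
    [(y, x)]. *)
Lemma card_leaf_pairs :
  (#|[set p : V * V | [&& e p.1 p.2, p.1 \in leaves e & p.2 \in leaves e]]|
    <= 2 * #|leaf_edges e|)%N.
Proof.
set P := [set p | _].
pose f (p : V * V) := [set p.1; p.2].
rewrite -sum1_card (partition_big f (mem (leaf_edges e))) /=; last first.
  move=> p; rewrite inE => /and3P[ep l1 l2]; rewrite inE; apply/andP; split.
    by apply/imsetP; exists p; rewrite ?inE.
  by apply/subsetP => x; rewrite in_set2 => /orP[]/eqP->.
rewrite mulnC -sum_nat_const; apply: leq_sum => s; rewrite inE.
case/andP => /imsetP[[x y] /= _ ->] _.
rewrite sum1dep_card (leq_trans (subset_leq_card (B := [set (x, y); (y, x)]) _)) //.
  apply/subsetP => -[u v]; rewrite !inE /f /= => /andP[/and3P[euv _ _]] /eqP E.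
  have uNv : u != v by apply: contraTneq euv => ->; rewrite e_irr.
  have : (u \in [set x; y]) && (v \in [set x; y]) by rewrite -E !inE !eqxx orbT.
  rewrite !in_set2 !xpair_eqE => /andP[/orP[]/eqP eu /orP[]/eqP ev];
    by rewrite eu ev !eqxx ?orbT // in uNv *.
by rewrite cards2; case: eqP.
Qed.

(** Meant for the moduli of the entries of [S]: symmetry lets a pair be charged to either end, and
    unit rows give both [a u v <= 1] and Cauchy-Schwarz. *)
Lemma sum_adjacent_le (C : numClosedFieldType) (a : V -> V -> C) :
  (forall u v, 0 <= a u v) -> (forall u v, a u v = a v u) ->
  (forall u, \sum_v a u v ^+ 2 = 1) ->
  \sum_u \sum_(v | e u v) a u v <= 2 * #|leaf_edges e|%:R
    + \sum_(v in inner e) sqrtC (3 * leaf_degree e v + degree e v)%:R.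
Proof.
move=> a_ge0 a_sym a_sq1.
have a_le1 u v : a u v <= 1.
  rewrite -(@ler_pXn2r _ 2) ?nnegrE // expr1n -(a_sq1 u) (bigD1 v) //=.
  by rewrite lerDl sumr_ge0 // => w _; rewrite exprn_ge0.
pose c v : C := (1 + (v \in leaves e))%:R.
have -> : \sum_u \sum_(v | e u v) a u v =
    \sum_(u | u \notin inner e) \sum_(v | e u v && (v \notin inner e)) a u v +
    \sum_(u in inner e) \sum_(v | e u v) c v * a u v.
  rewrite (bigID (mem (inner e))) /= addrC.
  rewrite [X in X + _ = _](eq_bigr (fun u =>
    \sum_(v | e u v && (v \notin inner e)) a u v +
    \sum_(v | e u v && (v \in inner e)) a u v)); last first.
    by move=> u _; rewrite (bigID (mem (inner e))) /= addrC.
  rewrite big_split /= -addrA; congr (_ + _).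
  (* Pairs from a non-inner [u] to an inner [v] are regrouped by [v]; they supply the second unit of
     weight that [c] puts on leaves. *)
  rewrite (exchange_big_dep (mem (inner e))) /=; last by move=> ? ? _ /andP[].
  rewrite -big_split /=; apply: eq_bigr => v v_in.
  rewrite (eq_bigl (fun u => e v u && (u \in leaves e))); last first.
    move=> u; rewrite v_in andbT andbC e_sym; case: (boolP (e v u)) => //= evu.
    by rewrite (mem_leaves_adjacent evu).
  rewrite big_mkcondr -big_split; apply: eq_bigr => u _ /=.
  rewrite /c natrD mulrDl mul1r addrC (a_sym u); case: (u \in leaves e).
    by rewrite mul1r.
  by rewrite mul0r.
apply: lerD; last apply: ler_sum => u _.
  have := card_leaf_pairs; set P := [set p | _] => cardP.
  apply: (@le_trans _ _ #|P|%:R); last by rewrite -natrM ler_nat.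
  rewrite pair_big_dep /= -sum1_card natr_sum.
  rewrite [leLHS](eq_bigl (fun p => p \in P)).
    by apply: ler_sum => p _; exact: a_le1.
  move=> [u v] /=; rewrite [RHS]in_set /= andbCA.
  case: (boolP (e u v)) => //= euv.
  by rewrite (mem_leaves_adjacent euv) (@mem_leaves_adjacent v u) // e_sym.
(* The sum is extended to all [v] by the weight [(e u v)%:R * c v], whose square is 4 on leaf
   neighbours, 1 on the other neighbours and 0 elsewhere. *)
rewrite big_mkcond /=.
rewrite (eq_bigr (fun v => (e u v)%:R * c v * a u v)); last first.
  by move=> v _; case: (e u v); rewrite ?mul1r // !mul0r.
have ec_ge0 v : 0 <= (e u v)%:R * c v by rewrite mulr_ge0 ?ler0n.
apply: le_trans (sum_le_sqrtC ec_ge0 (a_ge0 u) (a_sq1 u)) _.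
rewrite (_ : \sum_v _ = (3 * leaf_degree e u + degree e u)%:R) ?lexx //.
rewrite /leaf_degree /degree -!sum1_card !(big_mkcond (fun v => v \in _)) /=.
rewrite big_distrr -big_split natr_sum /=; apply: eq_bigr => v _.
rewrite /c in_setI [v \in neighbors e u]in_set.
by rewrite -natrM -natrX; case: (e u v) (v \in leaves e) => -[].
Qed.

End Graph.

Theorem theorem5 (C : numClosedFieldType) (V : finType) (e : rel V)
    (e_sym : symmetric e) (e_irr : irreflexive e) :
  energy e C <= 2 * #|leaf_edges e|%:R
    + \sum_(v in inner e) sqrtC (3 * leaf_degree e v + degree e v)%:R.
Proof.
have hA : adjacency e C \is hermsymmx.
  apply/is_hermitianmxP/matrixP => i j; rewrite expr0 scale1r !mxE e_sym.
  by rewrite conjC_nat.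
have [S [S_herm S_sq1 E_eq]] := sum_norm_eigenvalues_hermitian hA.
pose a u v := `|S (enum_rank u) (enum_rank v)|.
have a_sym u v : a u v = a v u.
  by rewrite /a -[in LHS]S_herm !mxE norm_conjC.
apply: le_trans (sum_adjacent_le e_sym e_irr (a := a) _ a_sym _).
(* The trace is a sum of complex terms; passing to the modulus of the energy makes the triangle
   inequality available. *)
- have <- : `|energy e C| = energy e C by rewrite ger0_norm ?sumr_ge0.
  rewrite /energy E_eq /mxtrace (reindex (@enum_rank V)) /=; last first.
    exact/onW_bij/enum_rank_bij.
  apply: (le_trans (ler_norm_sum _ _ _)); apply: ler_sum => u _.
  rewrite mxE (reindex (@enum_rank V)) /=; last exact/onW_bij/enum_rank_bij.
  rewrite [leRHS]big_mkcond; apply: (le_trans (ler_norm_sum _ _ _)).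
  apply: ler_sum => v _; rewrite mxE !enum_rankK a_sym /a.
  by case: (e u v); rewrite ?mul1r // mul0r normr0.
- by move=> u v; exact: normr_ge0.
(* The diagonal entry of [S *m S = 1%:M] at [u] is the squared norm of row [u], because [S] is
   Hermitian. *)
- move=> u; have := congr1 (fun M : 'M_ _ => M (enum_rank u) (enum_rank u)) S_sq1.
  rewrite !mxE eqxx mulr1n => <-.
  rewrite [RHS](reindex (@enum_rank V)) /=; last first.
    exact/onW_bij/enum_rank_bij.
  apply: eq_bigr => v _; rewrite /a normCK; congr (_ * _).
  by rewrite -[in RHS]S_herm !mxE.
Qed.
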